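(* Let $G$ be a weighted signed graph on vertex set $V$ and let $\pi^s\to\pi^t$ be an atomic $r$-edit operation with $r>1$ and set of moving vertices $W=\{u\in V:\pi^s(u)\ne\pi^t(u)\}$, where the associated partitions $P^s$ and $P^t$ are both optimal. Then for each $u\in W$, $$\gamma^{left}_u>\gamma^{right}_u,$$ where $$\gamma^{left}_u=\Omega(\{u\},W^s_{\pi^s(u)})-\Omega(\{u\},W^s_{\pi^t(u)}),\qquad \gamma^{right}_u=-\Omega(\{u\},W^t_{\pi^t(u)})+\Omega(\{u\},W^t_{\pi^s(u)}).$$
   Context: A weighted signed graph is a finite undirected loopless graph $(V,E)$ with nonzero real edge weights $a_{uv}=a_{vu}$ for $uv\in E$ (positive edge if $a_{uv}>0$, negative edge if $a_{uv}<0$), and $a_{uv}=0$ if $uv\notin E$; the unweighted case is $a_{uv}\in\{-1,0,1\}$. For $A,B\subseteq V$, $E(A,B)$ is the set of edges with one endpoint in $A$ and the other in $B$, and $\Omega(A,B)=\sum_{(u,v)\in E(A,B)}a_{uv}$. The imbalance $I(P)$ of a partition $P$ of $V$ is the sum of $a_{uv}$ over positive edges joining different modules of $P$ plus the sum of $-a_{uv}$ over negative edges inside modules of $P$. A partition is optimal if it minimizes $I$ over all partitions of $V$. A membership vector $\pi$ of a partition assigns to each vertex the label (a positive integer) of its module; vertices are in the same module iff they have equal labels. An edit operation $\pi^s\to\pi^t$ is a pair of a source and a target membership vector, with associated partitions $P^s,P^t$; its moving vertices are the $u$ with $\pi^s(u)\neq\pi^t(u)$ and its cost is $r=|W|$,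 where $W$ is the set of moving vertices; it is then called an $r$-edit operation. For a label $l$, $M^s_l=\{u:\pi^s(u)=l\}$, $M^t_l=\{u:\pi^t(u)=l\}$ (possibly empty), $W^s_l=W\cap M^s_l$ and $W^t_l=W\cap M^t_l$. Atomicity: an $r$-edit operation $\pi^s\to\pi^t$ (with $I(P^s)=I(P^t)$) with moving set $W$ is atomic if $I(P^s)<I(P^{t'})$ for every $r'$-edit operation $\pi^s\to\pi^{t'}$ with $1\le r'<r$ whose moving set $W'$ satisfies $W'\subset W$ and $\pi^{t'}(u)=\pi^t(u)$ for each $u\in W'$ (here $P^{t'}$ is the partition of $\pi^{t'}$). *)

(* Defs.v *)
From HB Require Import structures.
From mathcomp Require Import all_boot all_order all_algebra.
From mathcomp Require Import reals.

Set Implicit Arguments.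
Unset Strict Implicit.
Unset Printing Implicit Defensive.

Import Order.TTheory GRing.Theory Num.Theory.
Local Open Scope ring_scope.

(* The edge uv is the two-element set [set u; v], so that the weight is
   symmetric and loops are excluded by construction; the weight extends by 0
   to the sets that are not edges. *)
Record signed_graph (R : realType) (V : finType) := SignedGraph {
  edges : {set {set V}};
  weight : {set V} -> R;
  edge_card2 : forall e, e \in edges -> #|e| = 2%N;
  weight_neq0 : forall e, (weight e != 0) = (e \in edges) }.

Section Imbalance.
Variables (R : realType) (V : finType) (G : signed_graph R V).

Definition edges_between (A B : {set V}) : {set {set V}} :=
  [set e in edges G | [exists x in A, [exists y in B, e == [set x; y]]]].

Definition Omega (A B : {set V}) : R :=
  \sum_(e in edges_between A B) weight G e.

Definition joins_modules (P : {set {set V}}) (e : {set V}) : bool :=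
  [exists A in P, [exists B in P, (A != B) && (e \in edges_between A B)]].

Definition inside_module (P : {set {set V}}) (e : {set V}) : bool :=
  [exists A in P, e \subset A].

Definition imbalance (P : {set {set V}}) : R :=
  \sum_(e in edges G | (0 < weight G e) && joins_modules P e) weight G e
  + \sum_(e in edges G | (weight G e < 0) && inside_module P e) (- weight G e).

Definition optimal (P : {set {set V}}) : Prop :=
  partition P [set: V] /\
  forall Q : {set {set V}}, partition Q [set: V] -> imbalance P <= imbalance Q.

End Imbalance.

Record membership (V : finType) := Membership {
  label :> V -> nat;
  label_gt0 : forall u, (0 < label u)%N }.

Section EditOperation.
Variable V : finType.

Definition partition_of (p : membership V) : {set {set V}} :=
  preim_partition p [set: V].

Definition module (p : membership V) (l : nat) : {set V} :=
  [set u | p u == l].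

Definition moving (s t : membership V) : {set V} := [set u | s u != t u].

Definition edit_operation (r : nat) (s t : membership V) : Prop :=
  #|moving s t| = r.

Definition moving_source (s t : membership V) (l : nat) : {set V} :=
  moving s t :&: module s l.

Definition moving_target (s t : membership V) (l : nat) : {set V} :=
  moving s t :&: module t l.

End EditOperation.

Section Atomicity.
Variables (R : realType) (V : finType) (G : signed_graph R V).

Definition atomic (r : nat) (s t : membership V) : Prop :=
  [/\ edit_operation r s t,
      imbalance G (partition_of s) = imbalance G (partition_of t)
    & forall (r' : nat) (t' : membership V),
        edit_operation r' s t' -> (1 <= r' < r)%N ->
        moving s t' \subset moving s t ->
        {in moving s t', t' =1 t} ->
        imbalance G (partition_of s) < imbalance G (partition_of t')].

Definition gamma_left (s t : membership V) (u : V) : R :=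
  Omega G [set u] (moving_source s t (s u))
  - Omega G [set u] (moving_source s t (t u)).

Definition gamma_right (s t : membership V) (u : V) : R :=
  - Omega G [set u] (moving_target s t (t u))
  + Omega G [set u] (moving_target s t (s u)).

End Atomicity.

(* Main.v *)
Require Import Defs.
From mathcomp Require Import all_boot all_order all_algebra.
From mathcomp Require Import reals.
From mathcomp Require Import lra.

Set Implicit Arguments.
Unset Strict Implicit.
Unset Printing Implicit Defensive.

Import Order.TTheory GRing.Theory Num.Theory.
Local Open Scope ring_scope.

(** Up to a constant, the imbalance of a partition is minus the total weight of
    the edges inside its modules, so moving one vertex [u] changes it by a
    difference of two sums [Omega {u} M].  By atomicity, moving only [u] away
    from [s] strictly increases the imbalance, and so does moving all of [W]
    except [u], which amounts to moving [u] back from [t].  Adding the two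
    inequalities, the vertices outside [W] cancel because their labels in [s]
    and [t] agree. *)

(** Stated on labels rather than on blocks, so that two membership vectors can be compared edge by
    edge. *)
Definition monochromatic (V : finType) (p : V -> nat) (e : {set V}) : bool :=
  [forall x in e, forall y in e, p x == p y].

Lemma monochromaticP (V : finType) (p : V -> nat) (e : {set V}) :
  reflect {in e &, forall x y, p x = p y} (monochromatic p e).
Proof.
apply: (iffP forall_inP) => [h x y xe ye | h x xe].
  by apply/eqP; move/forall_inP: (h x xe); apply.
by apply/forall_inP => y ye; apply/eqP/h.
Qed.

Lemma monochromatic2 (V : finType) (p : V -> nat) (x y : V) :
  monochromatic p [set x; y] = (p x == p y).
Proof.
apply/monochromaticP/eqP => [pP | pxy a b]; first by rewrite (pP x y) ?set21 ?set22.
by move=> /set2P[] -> /set2P[] ->.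
Qed.

(** * Blocks of the partition of a membership vector *)

Section PartitionOf.
Variables (V : finType) (p : membership V).

Lemma partition_ofP : partition (partition_of p) [set: V].
Proof. exact: preim_partitionP. Qed.

Lemma mem_pblock_partition_of x y :
  (y \in pblock (partition_of p) x) = (p x == p y).
Proof.
by rewrite pblock_equivalence_partition ?inE // => a b c _ _ _; split=> // /eqP->.
Qed.

Lemma pblock_partition_of_mem x : pblock (partition_of p) x \in partition_of p.
Proof. by rewrite pblock_mem // (cover_partition partition_ofP) inE. Qed.

Lemma def_pblock_partition_of A x :
  A \in partition_of p -> x \in A -> A = pblock (partition_of p) x.
Proof. by move=> PA xA; rewrite (def_pblock (partition_trivIset partition_ofP) PA). Qed.

Lemma inside_module_partition_of (e : {set V}) :
  e != set0 -> inside_module (partition_of p) e = monochromatic p e.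
Proof.
case/set0Pn => z ze; apply/exists_inP/monochromaticP => [[A PA /subsetP eA] x y | h].
  move=> /eA xA /eA yA; apply/eqP.
  by rewrite -mem_pblock_partition_of -(def_pblock_partition_of PA xA).
exists (pblock (partition_of p) z); first exact: pblock_partition_of_mem.
by apply/subsetP => x xe; rewrite mem_pblock_partition_of (h z x).
Qed.

End PartitionOf.

(** * Imbalance and [Omega] as sums over edges and vertices *)

Section SignedGraph.
Variables (R : realType) (V : finType) (G : signed_graph R V).

Lemma edge_set2 (u : V) e :
  e \in edges G -> u \in e -> exists2 v, v != u & e = [set u; v].
Proof.
move=> /edge_card2/eqP/cards2P[x [y [xy ->]]] /set2P[] ->.
  by exists y; rewrite 1?eq_sym.
by exists x; rewrite // setUC.
Qed.

Lemma edge_neq0 e : e \in edges G -> e != set0.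
Proof. by move/edge_card2 => e2; rewrite -card_gt0 e2. Qed.

Lemma weight_set1 (u : V) : weight G [set u] = 0.
Proof.
apply/eqP; rewrite -[_ == _]negbK (weight_neq0 G).
by apply/negP => /edge_card2; rewrite cards1.
Qed.

Lemma mem_edges_between (A B : {set V}) x y :
  [set x; y] \in edges G ->
  ([set x; y] \in edges_between G A B) =
    ((x \in A) && (y \in B)) || ((y \in A) && (x \in B)).
Proof.
move=> xyG; have /eqP := edge_card2 xyG; rewrite cards2 eqSS eqb1 => xDy.
rewrite inE xyG /=; apply/exists_inP/orP => [[a aA /exists_inP[b bB /eqP exy]]|].
  have /set2P[ax|ay] : a \in [set x; y] by rewrite exy set21.
    have /set2P[yx|yb] : y \in [set a; b] by rewrite -exy set22.
      by rewrite yx ax eqxx in xDy.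
    by left; rewrite -ax yb aA.
  have /set2P[xy|xb] : x \in [set a; b] by rewrite -exy set21.
    by rewrite xy ay eqxx in xDy.
  by right; rewrite -ay xb aA.
case=> /andP[hA hB].
  by exists x => //; apply/exists_inP; exists y.
by exists y => //; apply/exists_inP; exists x => //; rewrite setUC.
Qed.

Lemma joins_modules_partition_of (p : membership V) e :
  e \in edges G -> joins_modules G (partition_of p) e = ~~ monochromatic p e.
Proof.
move=> eG; have /eqP/cards2P[x [y [_ exy]]] := edge_card2 eG; subst e.
rewrite monochromatic2; apply/exists_inP/idP => [[A PA /exists_inP[B PB]]|pxy].
  rewrite mem_edges_between // => /andP[AB].
  move=> AxBy; apply: contraNN AB => /eqP pxy.
  have blkE : pblock (partition_of p) x = pblock (partition_of p) y.
    by apply/setP => z; rewrite !mem_pblock_partition_of pxy.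
  by case/orP: AxBy => /andP[/(def_pblock_partition_of PA)->
    /(def_pblock_partition_of PB)->]; rewrite blkE.
exists (pblock (partition_of p) x); first exact: pblock_partition_of_mem.
apply/exists_inP; exists (pblock (partition_of p) y).
  exact: pblock_partition_of_mem.
rewrite mem_edges_between // !mem_pblock_partition_of !eqxx /= andbT.
apply: contraNneq pxy => /setP/(_ y).
by rewrite !mem_pblock_partition_of eqxx.
Qed.

(** A positive edge costs its weight unless it is monochromatic, a negative one costs minus its
    weight when it is. Either way the cost is the positive part of the weight minus the
    monochromatic weight; only the latter depends on [p]. *)
Lemma imbalance_partition_of (p : membership V) :
  imbalance G (partition_of p) =
    \sum_(e in edges G | 0 < weight G e) weight G e
    - \sum_(e in edges G | monochromatic p e) weight G e.
Proof.
rewrite /imbalance !big_mkcondr -sumrN -!big_split /=.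
apply: eq_bigr => e eG.
rewrite joins_modules_partition_of // inside_module_partition_of ?edge_neq0 //.
have := weight_neq0 G e; rewrite eG.
by case: ltgtP => //= _ _; case: monochromatic => /=; lra.
Qed.

(** The map sending [v] to [[set u; v]] is injective on the neighbours of [u], and pairs that are
    not edges weigh 0. The vertex form makes [Omega] additive in [A]. *)
Lemma Omega_set1 (u : V) (A : {set V}) :
  Omega G [set u] A = \sum_(v in A) weight G [set u; v].
Proof.
pose N := [set v in A | [set u; v] \in edges G].
transitivity (\sum_(v in N) weight G [set u; v]).
  rewrite /Omega -(big_imset (h := fun v => [set u; v])) => [|v w /=]; last first.
    move=> _; rewrite inE => /andP[_ uwG] uvw.
    have uvG : [set u; v] \in edges G by rewrite uvw.
    have /eqP := edge_card2 uvG; rewrite cards2 eqSS eqb1 eq_sym => vDu.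
    have : v \in [set u; w] by rewrite -uvw set22.
    by case/set2P => // /eqP; rewrite (negPf vDu).
  apply: eq_bigl => e; rewrite inE; apply/andP/imsetP.
    move=> [eG /exists_inP[x /set1P-> /exists_inP[v vA /eqP exy]]].
    by exists v; rewrite // inE vA -exy.
  move=> [v /setIdP[vA uvG] ->]; split=> //.
  apply/exists_inP; exists u; first exact: set11.
  by apply/exists_inP; exists v.
rewrite [LHS]big_mkcond [RHS]big_mkcond /=; apply: eq_bigr => v _.
rewrite inE; case: (v \in A) => //=.
by rewrite -(weight_neq0 G); case: eqP.
Qed.

(** The two modules differ at most in [u], whose term is the weight of the singleton [[set u]],
    hence 0. *)
Lemma Omega_module_eq_off (u : V) (p q : membership V) (l : nat) :
  {in predC1 u, p =1 q} ->
  Omega G [set u] (module p l) = Omega G [set u] (module q l).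
Proof.
move=> pq; rewrite !Omega_set1 [LHS]big_mkcond [RHS]big_mkcond /=; apply: eq_bigr => v _.
rewrite !inE; have [->|vu] := eqVneq v u; last by rewrite pq.
by rewrite setUid weight_set1 !if_same.
Qed.

Lemma Omega_moduleE (u : V) (p : membership V) :
  Omega G [set u] (module p (p u)) =
    \sum_(e in edges G | monochromatic p e && (u \in e)) weight G e.
Proof.
rewrite /Omega; apply: eq_bigl => e.
have [eG|eNG] /= := boolP (e \in edges G); last by rewrite inE (negPf eNG).
have [ue|uNe] := boolP (u \in e); last first.
  rewrite andbF inE eG /=; apply: contraNF uNe.
  by move=> /exists_inP[x /set1P-> /exists_inP[y _ /eqP->]]; rewrite set21.
have [v vu exy] := edge_set2 eG ue; subst e.
by rewrite mem_edges_between // monochromatic2 !inE eqxx (negPf vu) /= orbF andbT eq_sym.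
Qed.

(** Adding the [Omega] term cancels the monochromatic edges through [u] from the imbalance; what
    remains does not depend on the label of [u]. *)
Lemma imbalance_relabel (u : V) (p q : membership V) :
  {in predC1 u, p =1 q} ->
  imbalance G (partition_of p) + Omega G [set u] (module p (p u)) =
  imbalance G (partition_of q) + Omega G [set u] (module q (q u)).
Proof.
move=> pq; rewrite !imbalance_partition_of !Omega_moduleE.
have split_u (m : membership V) :
    \sum_(e in edges G | monochromatic m e) weight G e =
      \sum_(e in edges G | monochromatic m e && (u \in e)) weight G e
      + \sum_(e in edges G | monochromatic m e && (u \notin e)) weight G e.
  rewrite (bigID (fun e : {set V} => u \in e)) /=.
  by congr (_ + _); apply: eq_bigl => e; rewrite andbA.
rewrite (split_u p) (split_u q).
(* Edges avoiding [u] only see labels on which [p] and [q] agree. *)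
have -> : \sum_(e in edges G | monochromatic p e && (u \notin e)) weight G e =
          \sum_(e in edges G | monochromatic q e && (u \notin e)) weight G e.
  apply: eq_bigl => e; case: (boolP (u \in e)) => ue; rewrite ?andbF // !andbT.
  have offu x : x \in e -> p x = q x.
    by move=> xe; apply: pq; apply: contraNneq ue => <-.
  congr (_ && _); apply/monochromaticP/monochromaticP => h x y xe ye.
    by rewrite -!offu ?(h x y).
  by rewrite !offu ?(h x y).
lra.
Qed.

(** Both sides are the [Omega] from [u] to the non-moving vertices labelled [l], which are the same
    for [s] and [t]. *)
Lemma Omega_module_moving (s t : membership V) (u : V) (l : nat) :
  Omega G [set u] (module s l) - Omega G [set u] (moving_source s t l) =
  Omega G [set u] (module t l) - Omega G [set u] (moving_target s t l).
Proof.
have Omega_setD (A : {set V}) :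
    Omega G [set u] A - Omega G [set u] (moving s t :&: A) =
    Omega G [set u] (A :\: moving s t).
  by rewrite !Omega_set1 (big_setID (moving s t)) /= setIC addrAC subrr add0r.
rewrite /moving_source /moving_target !Omega_setD; congr (Omega G _ _).
by apply/setP => v; rewrite !inE negbK; case: eqP => //= ->.
Qed.

End SignedGraph.

(** * Hybrids of two membership vectors, exchanged at a single vertex *)

Definition relabel_at (V : finType) (p q : membership V) (u : V) : membership V :=
  @Membership V (fun v => if v == u then q v else p v)
    (fun v => if v == u as b return (0 < if b then q v else p v)%N
              then label_gt0 q v else label_gt0 p v).

Lemma relabel_atE (V : finType) (p q : membership V) (u : V) :
  relabel_at p q u u = q u.
Proof. by rewrite /= eqxx. Qed.

Lemma relabel_at_off (V : finType) (p q : membership V) (u : V) :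
  {in predC1 u, relabel_at p q u =1 p}.
Proof. by move=> v /negPf /= ->. Qed.

Lemma moving_relabel_at (V : finType) (s t : membership V) (u : V) :
  u \in moving s t -> moving s (relabel_at s t u) = [set u].
Proof.
rewrite inE => sut; apply/setP => v; rewrite !inE /=.
by have [->|] := eqVneq v u; rewrite ?eqxx.
Qed.

Lemma moving_relabel_at_target (V : finType) (s t : membership V) (u : V) :
  moving s (relabel_at t s u) = moving s t :\ u.
Proof.
apply/setP => v; rewrite !inE /=.
by have [->|] := eqVneq v u; rewrite ?eqxx.
Qed.

Theorem mainTheorem5 (R : realType) (V : finType) (G : signed_graph R V)
    (r : nat) (s t : membership V)
    (hr : (1 < r)%N)
    (hatomic : atomic G r s t)
    (hs : optimal G (partition_of s))
    (ht : optimal G (partition_of t)) :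
  forall u : V, u \in moving s t -> gamma_left G s t u > gamma_right G s t u.
Proof.
move=> u uW; case: hatomic => hW Ist hmin.
(* Atomicity for the edit moving [u] alone; its cost 1 is below [r] because [1 < r]. *)
have Is : imbalance G (partition_of s) < imbalance G (partition_of (relabel_at s t u)).
  apply: (hmin 1%N) => //; rewrite ?/edit_operation moving_relabel_at // ?cards1 //.
    by rewrite sub1set.
  by move=> v /set1P->; rewrite relabel_atE.
(* Atomicity for the edit moving all of [W] but [u]; its cost [r.-1] is at least 1, again because
   [1 < r]. *)
have It : imbalance G (partition_of s) < imbalance G (partition_of (relabel_at t s u)).
  have cW : #|moving s t :\ u| = r.-1.
    by move: hW; rewrite /edit_operation (cardsD1 u) uW => <-.
  apply: (hmin r.-1); rewrite /edit_operation ?moving_relabel_at_target //.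
  - by case: r hr {hW hmin cW} => [|[|r]] //= _; rewrite ltnSn.
  - exact: subsetDl.
  - by move=> v /setD1P[vu _]; apply: relabel_at_off.
have := imbalance_relabel G (@relabel_at_off _ s t u).
have := imbalance_relabel G (@relabel_at_off _ t s u).
(* Modules of the hybrids become modules of [s] and [t], so [Is] and [It], with [Ist], say that [u]
   has strictly larger [Omega] to its own module than to the other one, in [s] and in [t]. *)
rewrite !relabel_atE !(Omega_module_eq_off G _ (@relabel_at_off _ _ _ _)).
have := Omega_module_moving G s t u (s u).
have := Omega_module_moving G s t u (t u).
rewrite /gamma_left /gamma_right; lra.
Qed.
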